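(* Let $\mathcal{A}$ be an étale $\mathbf{Q}$-algebra of dimension $n$ and $\mathcal{O}$ an order in $\mathcal{A}$. Let $T$ and $M$ be the Gram matrices of $T_{\mathcal{O}}^\perp$ and $M_{\mathcal{O}}^\perp$, respectively, with respect to some $\mathbf{Z}$-basis of $\mathcal{O}^\perp$. Then $MT^{-1}M=T$.
   Context: $\mathcal{A}\cong K_1\times\cdots\times K_r$ with $K_i$ number fields; the $n$ ring homomorphisms $\mathcal{A}\to\mathbf{C}$ are $\sigma_{i,k}\circ\mathrm{pr}_i$, where $\sigma_{i,1},\dots,\sigma_{i,d_i}$ are the embeddings of $K_i$; list them as $\tau_1,\dots,\tau_n$. An order is a subring that is a full-rank lattice in $\mathcal{A}$. With $\mathrm{tr}:\mathcal{A}\to\mathbf{Q}$ the trace, define $\alpha^\perp=n\alpha-\mathrm{tr}(\alpha)$ and $\mathcal{O}^\perp=\{\alpha^\perp:\alpha\in\mathcal{O}\}$ (free of rank $n-1$). $M_{\mathcal{O}}^\perp$ is the bilinear form $(u,v)\mapsto\sum_{k=1}^n\tau_k(u)\overline{\tau_k(v)}$ on $\mathcal{O}^\perp$ and $T_{\mathcal{O}}^\perp$ is $(u,v)\mapsto\mathrm{tr}(uv)$ on $\mathcal{O}^\perp$. *)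

(* Defs.v *)
From HB Require Import structures.
From mathcomp Require Import all_boot all_order all_algebra all_field.
From mathcomp Require Import complex.
From mathcomp Require Import reals.

Set Implicit Arguments.
Unset Strict Implicit.
Unset Printing Implicit Defensive.

Import Order.TTheory GRing.Theory Num.Theory.
Local Open Scope ring_scope.

(* The family f is a Q-algebra isomorphism from A onto the product of the
   number fields K i; {dffun forall i, K i} carries no ring structure in the
   library, so the morphism property is stated componentwise. An falgType is a
   nonzero ring, hence the zero algebra (n = 0) is excluded. *)
Definition etale (A : falgType rat) : Prop :=
  exists (r : nat) (K : 'I_r -> fieldExtType rat)
         (f : forall i : 'I_r, {lrmorphism A -> K i}),
    bijective (fun a : A => [ffun i => f i a] : {dffun forall i : 'I_r, K i}).

Definition Zspanned_by (V : zmodType) (L : V -> Prop) m (b : m.-tuple V) :=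
  forall x, L x <-> inIntSpan b x.

Definition Zfree (V : zmodType) m (b : m.-tuple V) :=
  forall c : 'I_m -> int,
    \sum_(i < m) tnth b i *~ c i = 0 -> forall i, c i = 0.

Definition Zbasis (V : zmodType) (L : V -> Prop) m (b : m.-tuple V) :=
  Zspanned_by L b /\ Zfree b.

Definition full_lattice (V : vectType rat) (L : V -> Prop) :=
  exists b : (\dim {:V}).-tuple V, basis_of {:V} b /\ Zspanned_by L b.

(* A full-rank lattice has decidable membership, so taking O to be a boolean
   predicate loses no generality. *)
Definition is_order (A : falgType rat) (O : {pred A}) :=
  subring_closed O /\ full_lattice (fun x => x \in O).

Section Forms.

Variable A : falgType rat.

Definition algtr (a : A) : rat :=
  \tr (passmx.mxof (vbasis {:A}) (vbasis {:A}) (amull a)).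

Definition perp (a : A) : A := a *+ \dim {:A} - (algtr a)%:A.

Definition perp_set (O : {pred A}) (x : A) : Prop :=
  exists2 a, a \in O & x = perp a.

Definition trace_form (u v : A) : rat := algtr (u * v).

Variable C : numClosedFieldType.

Definition lists_homs n (tau : 'I_n -> {rmorphism A -> C}) : Prop :=
  forall f : {rmorphism A -> C}, exists! k : 'I_n, tau k =1 f.

Definition mink_form n (tau : 'I_n -> {rmorphism A -> C}) (u v : A) : C :=
  \sum_(k < n) tau k u * (tau k v)^*.

End Forms.

Definition gram (V S : Type) (B : V -> V -> S) m (b : m.-tuple V) : 'M[S]_m :=
  \matrix_(i, j) B (tnth b i) (tnth b j).

(* Main.v *)
(** Let B be the complex matrix with entries tau_k(b_i) and Bc its conjugate.
    The n distinct homomorphisms are linearly independent (Dedekind), so they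
    diagonalise multiplication by an element and tr = sum_k tau_k; hence
    T = B B^T, and T = Bc Bc^T because T is rational. Conjugation permutes the
    tau_k, so M = B Bc^T = Bc B^T. The rows of B are a basis of the hyperplane
    of vectors with zero coordinate sum, which is orthogonal to (1, ..., 1);
    this makes T invertible and yields Bc = X B for some X. Therefore
    M = X T = T X^T and M T^-1 M = X T X^T = Bc Bc^T = T. *)

Require Import Defs.
From HB Require Import structures.
From mathcomp Require Import all_boot all_order all_algebra all_field.
From mathcomp Require Import complex.
From mathcomp Require Import reals boolp ring.

Set Implicit Arguments.
Unset Strict Implicit.
Unset Printing Implicit Defensive.

Import Order.TTheory GRing.Theory Num.Theory passmx.
Local Open Scope ring_scope.

(** * Linear algebra in the hyperplane of zero coordinate sum *)

Section ZeroRowSums.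

Variables (F : fieldType) (m n : nat) (B : 'M[F]_(m, n)).
Hypothesis nF : n%:R != 0 :> F.
Hypothesis B0 : B *m const_mx 1 = 0 :> 'cV_m.
Hypothesis Bfull : (1%:M <= B + (const_mx 1 : 'rV_n))%MS.

(** Decompose [Y] along the rows of [B] and the all-ones row with coefficients [u] and [v].
    Multiplying by the all-ones column kills [Y] and [B] and leaves [n] times [v], so [v = 0]. *)
Lemma submx_zero_row_sums p (Y : 'M_(p, n)) :
  Y *m const_mx 1 = 0 :> 'cV_p -> (Y <= B)%MS.
Proof.
move=> Y0.
have /sub_addsmxP[[u v] /= Yuv] : (Y <= B + (const_mx 1 : 'rV_n))%MS.
  exact: submx_trans (submx1 _) Bfull.
have : v *m (const_mx 1 : 'rV_n) *m (const_mx 1 : 'cV_n) = 0.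
  by move: Y0; rewrite Yuv mulmxDl -mulmxA B0 mulmx0 add0r.
rewrite -mulmxA (_ : _ *m const_mx 1 = n%:R%:M); last first.
  apply/matrixP => i j; rewrite !ord1 !mxE eqxx mulr1n.
  under eq_bigr do rewrite !mxE mulr1.
  by rewrite sumr_const card_ord.
rewrite mul_mx_scalar => /eqP; rewrite scaler_eq0 (negPf nF) /= => /eqP v0.
by rewrite Yuv v0 mul0mx addr0 submxMl.
Qed.

(** If [v] kills [B *m B^T], then [v *m B] is orthogonal to the rows of [B] and, by [B0], to the
    all-ones row. Together these span everything, so [v *m B = 0]. *)
Lemma unitmx_mul_trmx : row_free B -> B *m B^T \in unitmx.
Proof.
move=> Bfree; rewrite -row_free_unit; apply: inj_row_free => v vBB.
have /sub_addsmxP[[x y] /= Exy] := Bfull.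
suff: v *m B *m 1%:M^T = 0.
  by rewrite trmx1 mulmx1 => vB; apply: (row_free_inj Bfree); rewrite vB mul0mx.
rewrite Exy linearD /= !trmx_mul mulmxDr !mulmxA -(mulmxA v B) vBB mul0mx add0r.
by rewrite trmx_const -(mulmxA v B) B0 mulmx0 mul0mx.
Qed.

End ZeroRowSums.

(** * Homomorphisms to [C]: linear independence and conjugation *)

Section Homs.

Variables (C : numClosedFieldType) (A : falgType rat).

Lemma rmorph_ratZ (f : {rmorphism A -> C}) q a : f (q *: a) = ratr q * f a.
Proof.
by rewrite -mulr_algl rmorphM -(fmorph_eq_rat (f \o in_alg A)).
Qed.

Definition hom_mx {n} (tau : 'I_n -> {rmorphism A -> C}) {m} (b : m.-tuple A) :=
  \matrix_(i, k) tau k (tnth b i).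

Variable n : nat.
Variable tau : 'I_n -> {rmorphism A -> C}.
Hypothesis htau : lists_homs tau.

Lemma lists_homs_inj k l : tau k =1 tau l -> k = l.
Proof.
by move=> E; have [j [_ u]] := htau (tau l); rewrite -(u _ E); apply: u.
Qed.

(* [g] is a product over [l \in s] of factors [tau _ a - tau l a], with [a]
   separating [tau k] from [tau l]. *)
Lemma hom_separator (s : seq 'I_n) k : k \notin s ->
  exists g : 'I_n -> C, [/\ g k != 0, {in s, forall l, g l = 0} &
    forall w : 'I_n -> C, (forall a, \sum_l w l * tau l a = 0) ->
      forall a, \sum_l w l * g l * tau l a = 0].
Proof.
elim: s => [_|l s IHs].
  exists (fun=> 1); split=> [||w w0 a]; rewrite ?oner_eq0 //.
  by rewrite -[RHS](w0 a); apply: eq_bigr => l _; rewrite mulr1.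
rewrite inE negb_or => /andP[neq_kl /IHs[g [gk gs gw]]].
have [a Da] : exists a, tau k a != tau l a.
  apply: contrapT => /forallNP E; move/eqP: neq_kl; apply.
  by apply: lists_homs_inj => a; apply/eqP/negPn/negP/E.
exists (fun j => g j * (tau j a - tau l a)); split=> [|j|w w0 c].
- by rewrite mulf_neq0 ?subr_eq0.
- by rewrite inE => /predU1P[->|/gs->]; rewrite ?subrr ?mulr0 ?mul0r.
(* Subtracting [tau l a] times the relation at [c] from the relation at [a * c] multiplies the
   coefficient of index [j] by [tau j a - tau l a]. *)
have := gw w w0 (a * c); have := gw w w0 c => /(congr1 (fun x => - tau l a * x)).
rewrite mulr0 mulr_sumr => E1 E2.
rewrite -[RHS]addr0 -[in X in _ = X + _]E2 -[in X in _ = _ + X]E1 -big_split /=.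
by apply: eq_bigr => j _; rewrite rmorphM; ring.
Qed.

(* Dedekind's independence of characters. *)
Lemma homs_independent (w : 'I_n -> C) :
  (forall a, \sum_k w k * tau k a = 0) -> forall k, w k = 0.
Proof.
(* Separating [k] from all other indices and evaluating at [1] leaves only [w k * g k = 0]. *)
move=> w0 k; have [|g [gk gs /(_ w w0 1)]] := @hom_separator (enum (predC1 k)) k.
  by rewrite mem_enum !inE eqxx.
rewrite (bigD1 k) //= big1 => [|l lk]; last first.
  by rewrite gs ?mem_enum ?inE // mulr0 mul0r.
by rewrite rmorph1 mulr1 addr0 => /eqP; rewrite mulf_eq0 (negPf gk) orbF => /eqP.
Qed.

Lemma mink_form_sym u v : mink_form tau u v = mink_form tau v u.
Proof.
(* [s] is the permutation of the indices induced by complex conjugation; reindexing by it exchanges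
   the conjugated and unconjugated factors. *)
have /choice[s Ds] : forall k, exists l, tau l =1 Num.conj \o tau k.
  by move=> k; have [l []] := htau (Num.conj \o tau k); exists l.
have sK : involutive s.
  by move=> k; apply: lists_homs_inj => a; rewrite Ds /= Ds /= conjCK.
rewrite /mink_form (reindex_inj (inv_inj sK)).
by apply: eq_bigr => k _; rewrite !Ds /= conjCK mulrC.
Qed.

Lemma map_rVof_hom_mx a :
  map_mx ratr (rVof (vbasis {:A}) a) *m hom_mx tau (vbasis {:A}) =
  \row_k tau k a.
Proof.
apply/rowP => k; rewrite !mxE [in RHS](coord_vbasis (memvf a)) rmorph_sum.
by apply: eq_bigr => j _; rewrite !mxE rmorph_ratZ (tnth_nth 0).
Qed.

End Homs.

(** * Trace and Gram matrices through the homomorphisms *)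

Section FullHoms.

Variables (C : numClosedFieldType) (A : falgType rat).
Notation n := (\dim {:A}).
Variable tau : 'I_n -> {rmorphism A -> C}.
Hypothesis htau : lists_homs tau.
Let e := vbasis {:A}.

(** A vector killing the transpose is a linear relation among the [tau k] on a basis, hence on all
    of [A], so it vanishes by independence. *)
Lemma unitmx_hom_mx : hom_mx tau e \in unitmx.
Proof.
rewrite -unitmx_tr -row_free_unit; apply: inj_row_free => w w0.
apply/rowP => k; rewrite mxE; move: k.
apply: (homs_independent htau) => a.
have := congr1 (fun z => (map_mx ratr (rVof e a) *m z^T) 0 0) w0.
rewrite trmx_mul trmxK mulmxA map_rVof_hom_mx trmx0 mulmx0 !mxE => E0.
by rewrite -[RHS]E0; apply: eq_bigr => k _; rewrite !mxE mulrC.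
Qed.

Lemma ratr_algtr a : ratr (algtr a) = \sum_k tau k a :> C.
Proof.
set N := mxof e e (amull a); set P := hom_mx tau e.
(* By multiplicativity, column [k] of [P] is an eigenvector of [N] with eigenvalue [tau k a]. *)
have NP : map_mx ratr N *m P = P *m diag_mx (\row_k tau k a).
  apply/row_matrixP => j; rewrite row_mul -map_row [row j N]rowE.
  rewrite mul_mxof vecof_delta map_rVof_hom_mx.
  rewrite mul_mx_diag; apply/rowP => k.
  by rewrite !mxE lfunE /= rmorphM mulrC (tnth_nth 0).
rewrite /algtr -/e -/N -trace_map_mx.
rewrite -[map_mx _ _](mulmxK unitmx_hom_mx) NP mxtrace_mulC mulmxA.
rewrite mulVmx ?unitmx_hom_mx // mul1mx mxtrace_diag.
by apply: eq_bigr => k _; rewrite mxE.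
Qed.

Lemma algtr_perp (a : A) : algtr (perp a) = 0.
Proof.
apply: (fmorph_inj (ratr : rat -> C)); rewrite rmorph0 /= ratr_algtr /perp.
under eq_bigr do rewrite rmorphB rmorphMn /= rmorph_ratZ rmorph1 mulr1.
by rewrite sumrB sumrMnl -ratr_algtr sumr_const card_ord subrr.
Qed.

Section Basis.

Variables (m : nat) (b : m.-tuple A).

(** The matrix factors as the rational coordinates [N] of [b] times an invertible matrix, and the
    rank of [N] is the same over [C]. *)
Lemma row_free_hom_mx : free b -> row_free (hom_mx tau b).
Proof.
move=> /freeP bfree.
pose N := \matrix_(i < m) rVof e (tnth b i).
have -> : hom_mx tau b = map_mx ratr N *m hom_mx tau e.
  apply/row_matrixP => i; rewrite row_mul -map_row rowK map_rVof_hom_mx.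
  by apply/rowP => k; rewrite !mxE.
rewrite /row_free mxrankMfree ?row_free_unit ?unitmx_hom_mx // mxrank_map.
apply: inj_row_free => v vN; apply/rowP => i; rewrite mxE.
apply: bfree i; apply: (can_inj (rVofK (vbasisP {:A}))).
rewrite linear0 -vN mulmx_sum_row linear_sum; apply: eq_bigr => i _.
by rewrite linearZ rowK (tnth_nth 0).
Qed.

(** The element [1] has the all-ones row as its image, so rational decompositions along [b] and [1]
    carry over to the rows of an invertible matrix. *)
Lemma hom_mx_full : ({:A} <= <<b>> + <[1]>)%VS ->
  (1%:M <= hom_mx tau b + (const_mx 1 : 'rV_n))%MS.
Proof.
move=> bspan; apply: (@submx_trans _ _ _ _ _ _ (hom_mx tau e)).
  by rewrite sub1mx row_full_unit unitmx_hom_mx.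
apply/row_subP => j.
have /memv_addP[u /coord_span Eu [v /vlineP[c ->] Ev]] :=
  subvP bspan _ (memvf (tnth e j)).
have -> : row j (hom_mx tau e) =
    (\row_i ratr (coord b i u)) *m hom_mx tau b + ratr c *: const_mx 1.
  apply/rowP => k; rewrite !mxE Ev rmorphD rmorph_ratZ rmorph1; congr (_ + _).
  rewrite [in LHS]Eu rmorph_sum; apply: eq_bigr => i _.
  by rewrite rmorph_ratZ !mxE (tnth_nth 0).
by rewrite addmx_sub_adds ?submxMl ?scalemx_sub.
Qed.

Lemma hom_mx_row_sums :
  (forall i, algtr (tnth b i) = 0) -> hom_mx tau b *m const_mx 1 = 0 :> 'cV_m.
Proof.
move=> b0; apply/matrixP => i j; rewrite !mxE -[RHS](rmorph0 (ratr : rat -> C)).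
by rewrite -(b0 i) /= ratr_algtr; apply: eq_bigr => k _; rewrite !mxE mulr1.
Qed.

Lemma gram_trace_mink :
    (forall i, algtr (tnth b i) = 0) -> free b ->
    ({:A} <= <<b>> + <[1]>)%VS ->
  let T := gram (@trace_form A) b in let TC := map_mx ratr T in
  let M := gram (mink_form tau) b in
  T \in unitmx /\ M *m invmx TC *m M = TC.
Proof.
move=> b0 bfree bspan T TC M.
pose B := hom_mx tau b; pose Bc := map_mx Num.conj B.
have nC : n%:R != 0 :> C by rewrite pnatr_eq0 -lt0n adim_gt0.
have B0 : B *m const_mx 1 = 0 :> 'cV_m by exact: hom_mx_row_sums.
have Bc0 : Bc *m const_mx 1 = 0 :> 'cV_m.
  have := congr1 (map_mx Num.conj) B0.
  by rewrite map_mxM map_const_mx rmorph1 map_mx0.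
have DTC : TC = B *m B^T.
  apply/matrixP => i j; rewrite !mxE /trace_form ratr_algtr.
  by apply: eq_bigr => k _; rewrite !mxE rmorphM.
have DM : M = B *m Bc^T.
  by apply/matrixP => i j; rewrite !mxE; apply: eq_bigr => k _; rewrite !mxE.
have DM' : M = Bc *m B^T.
  apply/matrixP => i j; rewrite !mxE mink_form_sym //.
  by apply: eq_bigr => k _; rewrite !mxE mulrC.
have DTC' : TC = Bc *m Bc^T.
  rewrite map_trmx -map_mxM -DTC; apply/matrixP => i j.
  by rewrite !mxE fmorph_rat.
have Tu : TC \in unitmx.
  by rewrite DTC (unitmx_mul_trmx B0) ?hom_mx_full ?row_free_hom_mx.
have /submxP[X DX] := submx_zero_row_sums nC B0 (hom_mx_full bspan) Bc0.
split; first by rewrite map_unitmx in Tu.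
have MX : M = X *m TC by rewrite DM' DX -mulmxA DTC.
have MX' : M = TC *m X^T by rewrite DM DX trmx_mul mulmxA DTC.
rewrite {1}MX mulmxK // MX' mulmxA.
by rewrite DTC mulmxA -DX -mulmxA -trmx_mul -DX -DTC' DTC.
Qed.

End Basis.

End FullHoms.

(** * From integral bases to rational linear algebra *)

Lemma Zfree_free (V : vectType rat) m (b : m.-tuple V) : Zfree b -> free b.
Proof.
move=> bfree; apply/freeP => k k0 i.
(* Clearing denominators: [c j] is [k j] times the product of all denominators, written as an
   integer. *)
pose c j := numq (k j) * \prod_(l | l != j) denq (k l).
have Dc j : (c j)%:~R = (\prod_l denq (k l))%:~R * k j.
  by rewrite (bigD1 j) //= !rmorphM /= numqE; ring.
suff: c i = 0.
  move=> /(congr1 (fun z => z%:~R : rat)); rewrite Dc => /eqP.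
  rewrite mulf_eq0 intr_eq0 => /orP[|/eqP //].
  by move/prodf_eq0 => [l _]; rewrite (negPf (denq_neq0 _)).
apply: bfree.
transitivity ((\prod_l denq (k l))%:~R *: \sum_j k j *: b`_j); last first.
  by rewrite k0 scaler0.
by rewrite scaler_sumr; apply: eq_bigr => j _; rewrite -scaler_int Dc scalerA (tnth_nth 0).
Qed.

Lemma inIntSpan_span (V : vectType rat) m (b : m.-tuple V) x :
  inIntSpan b x -> x \in <<b>>%VS.
Proof.
move=> [a ->]; apply: memv_suml => i _; rewrite -scaler_int memvZ //.
by rewrite memv_span // mem_nth // size_tuple.
Qed.

Lemma inIntSpan_tnth (V : zmodType) m (b : m.-tuple V) i :
  inIntSpan b (tnth b i).
Proof.
exists [ffun j => (j == i)%:R]; rewrite (bigD1 i) //= ffunE eqxx mulr1z.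
rewrite big1 ?addr0 => [|j ji]; last by rewrite ffunE (negPf ji) mulr0z.
exact: tnth_nth.
Qed.

(** For [y] in a basis of the order, [n] times [y] is [perp y] plus a rational multiple of [1], and
    [n] is invertible in the rationals. *)
Lemma perp_lattice_span (A : falgType rat) (O : {pred A}) m (b : m.-tuple A) :
    full_lattice (fun x => x \in O) -> Zspanned_by (perp_set O) b ->
  ({:A} <= <<b>> + <[1]>)%VS.
Proof.
move=> [o [obasis oO]] bO; rewrite -[X in (X <= _)%VS](span_basis obasis).
apply/span_subvP => x /tnthP[i ->].
have : perp (tnth o i) \in <<b>>%VS.
  apply/inIntSpan_span/bO; exists (tnth o i) => //.
  exact/oO/inIntSpan_tnth.
set y := tnth o i => py.
have nQ : (\dim {:A})%:R != 0 :> rat by rewrite pnatr_eq0 -lt0n adim_gt0.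
rewrite -[y](scalerK nQ) memvZ // scaler_nat.
rewrite -[_ *+ _](subrK (algtr y)%:A) memv_add //.
by rewrite memvZ ?memv_line.
Qed.

Theorem theorem8p1 (R : realType) (A : falgType rat) (n : nat)
    (hA : etale A) (hn : \dim {:A} = n)
    (O : {pred A}) (hO : is_order O)
    (tau : 'I_n -> {rmorphism A -> R[i]%C}) (htau : lists_homs tau)
    (m : nat) (b : m.-tuple A) (hb : Zbasis (perp_set O) b) :
  let T : 'M[rat]_m := gram (@trace_form A) b in
  let TC : 'M[R[i]%C]_m := map_mx ratr T in
  let M : 'M[R[i]%C]_m := gram (mink_form tau) b in
  T \in unitmx /\ M *m invmx TC *m M = TC.
Proof.
case: n / hn tau htau => tau htau.
have [[_ Olat] [bO bfree]] := (hO, hb).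
apply: gram_trace_mink => // [i||]; last 2 first.
- exact: Zfree_free.
- exact: perp_lattice_span Olat bO.
have [a _ ->] : perp_set O (tnth b i) by apply/bO/inIntSpan_tnth.
exact: (algtr_perp htau).
Qed.
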